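(* Assume the continuum hypothesis. Then there is a compactification $\gamma\omega$ of $\omega$ such that the remainder $\gamma\omega\setminus\omega$ is homeomorphic to $S$, the Stone space of the measure algebra, and $C(\gamma\omega)$ contains a complemented copy of $c_0$ (that is, a closed subspace isomorphic to $c_0$ which is the range of a bounded linear projection on $C(\gamma\omega)$).
   Context: $\omega$ is the discrete space of natural numbers; compactifications are Hausdorff. $C(K)$ is the Banach space of real-valued continuous functions on a compact space $K$ with the supremum norm. The measure algebra is $\mathfrak{M}=Bor[0,1]/\mathcal{N}$, where $Bor[0,1]$ is the Borel $\sigma$-algebra of $[0,1]$ and $\mathcal{N}$ is the ideal of Lebesgue null sets; $S$ is the Stone space (space of ultrafilters) of $\mathfrak{M}$. *)

(* Defs.v *)
From HB Require Import structures.
From mathcomp Require Import all_boot all_order all_algebra generic_quotient.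
From mathcomp Require Import all_classical all_reals all_analysis.

Set Implicit Arguments.
Unset Strict Implicit.
Unset Printing Implicit Defensive.

Import Order.TTheory GRing.Theory Num.Theory.
Import numFieldNormedType.Exports.

Local Open Scope classical_set_scope.
Local Open Scope card_scope.
Local Open Scope ring_scope.

Definition continuum_hypothesis (R : realType) : Prop :=
  forall A : set R, countable A \/ A #= [set: R].

Definition homeomorphism (X Y : topologicalType) (f : X -> Y) : Prop :=
  exists g : Y -> X,
    [/\ cancel f g, cancel g f, continuous f & continuous g].

Definition homeomorphic (X Y : topologicalType) : Prop :=
  exists f : X -> Y, homeomorphism f.

(* [range f] is viewed as a type with the subspace topology. *)
Definition embedding (X Y : topologicalType) (f : X -> Y) : Prop :=
  exists2 h : X -> range f, homeomorphism h & forall x, set_val (h x) = f x.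

HB.mixin Record isCompactHausdorff T & Topological T := {
  compact_setT : compact [set: T];
  hausdorff_setT : hausdorff_space T
}.

#[short(type="compactHausdorffType")]
HB.structure Definition CompactHausdorff :=
  {T of Topological T & isCompactHausdorff T}.

Definition is_compactification (X : topologicalType)
    (K : compactHausdorffType) (i : X -> K) : Prop :=
  embedding i /\ dense (range i).

Section stone.
Context {d : Order.disp_t} (B : ctbDistrLatticeType d).
Local Open Scope order_scope.

Definition proper_filter (F : set B) : Prop :=
  [/\ F \top, ~ F \bot,
      forall a b, F a -> F b -> F (a `&` b) &
      forall a b, a <= b -> F a -> F b].

Definition ultrafilter (F : set B) : Prop :=
  proper_filter F /\
  forall G : set B, proper_filter G -> (F `<=` G)%classic -> G = F.

Definition stone : Type := set_type ultrafilter.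

HB.instance Definition _ := Choice.on stone.

Definition stone_base (a : B) : set stone := [set u | set_val u a].

Let stone_ultra (u : stone) : ultrafilter (set_val u).
Proof. exact: set_valP. Qed.

Let stone_cover : \bigcup_(U in range stone_base) id U = [set: stone].
Proof.
rewrite -subTset => u _; exists (stone_base \top); first by exists \top.
by have [[]] := stone_ultra u.
Qed.

Let stone_join (U V : set stone) (u : stone) :
  range stone_base U -> range stone_base V -> id U u -> id V u ->
  exists W, [/\ range stone_base W, id W u & (id W `<=` id U `&` id V)%classic].
Proof.
move=> [a _ <-] [b _ <-] /= ua ub; exists (stone_base (a `&` b)).
split; first by exists (a `&` b).
  by have [[_ _ + _] _] := stone_ultra u; exact.
move=> v /= vab; have [[_ _ _ vup] _] := stone_ultra v.
by split; apply: vup vab; [exact: leIl | exact: leIr].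
Qed.

HB.instance Definition _ := isBaseTopological.Build stone stone_cover stone_join.

End stone.

Section measure_algebra.
Context (R : realType).
Notation mu := (@lebesgue_measure R).

(* The Borel subsets of [0, 1] are the Borel subsets of R it contains; the
   canonical [measurable] on [R] is the (uncompleted) Borel sigma-algebra. *)
Definition borel01 : Type :=
  set_type [set A : set R | measurable A /\ A `<=` `[0, 1]].

HB.instance Definition _ := Choice.on borel01.

Implicit Types A B C D : borel01.

Fact borel01_m A : measurable (set_val A).
Proof. by case: (set_valP A). Qed.

Fact borel01_s A : set_val A `<=` `[0, 1].
Proof. by case: (set_valP A). Qed.

Definition borel01_mk (X : set R) (mX : measurable X) (sX : X `<=` `[0, 1]) :
  borel01 := exist _ X (mem_set (conj mX sX)).

Fact borel01I_s A B : set_val A `&` set_val B `<=` `[0, 1].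
Proof. by move=> x [/borel01_s]. Qed.

Fact borel01U_s A B : set_val A `|` set_val B `<=` `[0, 1].
Proof. by move=> x [] /borel01_s. Qed.

Fact borel01C_s A : `[0, 1] `\` set_val A `<=` `[0, 1].
Proof. by move=> x []. Qed.

Definition borel01I A B : borel01 :=
  borel01_mk (measurableI _ _ (borel01_m A) (borel01_m B)) (@borel01I_s A B).

Definition borel01U A B : borel01 :=
  borel01_mk (measurableU _ _ (borel01_m A) (borel01_m B)) (@borel01U_s A B).

Definition borel01C A : borel01 :=
  borel01_mk (measurableD (measurable_itv `[0, 1]) (borel01_m A))
    (@borel01C_s A).

Definition borel010 : borel01 := borel01_mk measurable0 (@sub0set _ _).

Definition borel01T : borel01 :=
  borel01_mk (measurable_itv `[0, 1]) (@subset_refl _ _).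

(* [`+`] is the symmetric difference *)
Definition null_eq A B : bool := mu (set_val A `+` set_val B) == 0%E.

Let null_sub (X Y Z : set R) : measurable X -> measurable Y -> measurable Z ->
  mu X = 0%E -> mu Y = 0%E -> Z `<=` X `|` Y -> mu Z = 0%E.
Proof.
move=> mX mY mZ X0 Y0 sZ; apply/eqP; rewrite eq_le measure_ge0 andbT.
apply: (le_trans (le_measure mu _ _ sZ)); rewrite ?inE//.
  exact: measurableU.
have h : (mu (X `|` Y) <= mu X + mu Y)%E by exact: measureU2.
by rewrite X0 Y0 adde0 in h.
Qed.

Let mY A B : measurable (set_val A `+` set_val B).
Proof. by apply: measurableU; apply: measurableD; exact: borel01_m. Qed.

Let null_eq_refl : reflexive null_eq.
Proof. by move=> A; rewrite /null_eq setYK measure0. Qed.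

Let null_eq_sym : symmetric null_eq.
Proof. by move=> A B; rewrite /null_eq setYC. Qed.

Let null_eq_trans : transitive null_eq.
Proof.
move=> B A C /eqP AB /eqP BC; apply/eqP.
apply: (null_sub _ _ _ AB BC); try exact: mY.
move=> x; rewrite /setY /=; have [?|?] := pselect (set_val B x); tauto.
Qed.

Canonical null_eq_equiv :=
  EquivRel null_eq null_eq_refl null_eq_sym null_eq_trans.

Local Open Scope quotient_scope.

Definition measure_algebra : Type := {eq_quot null_eq}.

HB.instance Definition _ := Choice.on measure_algebra.
HB.instance Definition _ := EqQuotient.on measure_algebra.

Local Notation pi := (\pi_measure_algebra).

Definition ma_meet (x y : measure_algebra) : measure_algebra :=
  pi (borel01I (repr x) (repr y)).
Definition ma_join (x y : measure_algebra) : measure_algebra :=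
  pi (borel01U (repr x) (repr y)).
Definition ma_compl (x : measure_algebra) : measure_algebra :=
  pi (borel01C (repr x)).
Definition ma_bot : measure_algebra := pi borel010.
Definition ma_top : measure_algebra := pi borel01T.
Definition ma_le (x y : measure_algebra) : bool := ma_meet x y == x.
Definition ma_lt (x y : measure_algebra) : bool := (y != x) && ma_le x y.

Lemma pi_null_eq A B : (pi A = pi B) <-> mu (set_val A `+` set_val B) = 0%E.
Proof. by split=> [/eqquotP/eqP//|h]; apply/eqquotP/eqP. Qed.

Let pi_val A B : set_val A = set_val B -> pi A = pi B.
Proof. by move=> h; apply/pi_null_eq; rewrite h setYK measure0. Qed.

Let reprY A : mu (set_val (repr (pi A)) `+` set_val A) = 0%E.
Proof. by apply/pi_null_eq; rewrite reprK. Qed.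

Let setY_setI (X Y X' Y' : set R) :
  (X `&` Y) `+` (X' `&` Y') `<=` (X `+` X') `|` (Y `+` Y').
Proof.
move=> x /=; have [?|?] := pselect (X x); have [?|?] := pselect (Y x);
by have [?|?] := pselect (X' x); have [?|?] := pselect (Y' x); tauto.
Qed.

Let setY_setU (X Y X' Y' : set R) :
  (X `|` Y) `+` (X' `|` Y') `<=` (X `+` X') `|` (Y `+` Y').
Proof.
move=> x /=; have [?|?] := pselect (X x); have [?|?] := pselect (Y x);
by have [?|?] := pselect (X' x); have [?|?] := pselect (Y' x); tauto.
Qed.

Let setY_setD (Z X X' : set R) :
  (Z `\` X) `+` (Z `\` X') `<=` (X `+` X') `|` (X `+` X').
Proof.
by move=> x /=; have [?|?] := pselect (X x); have [?|?] := pselect (X' x); tauto.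
Qed.

Lemma ma_meetE A B : ma_meet (pi A) (pi B) = pi (borel01I A B).
Proof.
apply/pi_null_eq; apply: (null_sub _ _ _ (reprY A) (reprY B)); try exact: mY.
exact: setY_setI.
Qed.

Lemma ma_joinE A B : ma_join (pi A) (pi B) = pi (borel01U A B).
Proof.
apply/pi_null_eq; apply: (null_sub _ _ _ (reprY A) (reprY B)); try exact: mY.
exact: setY_setU.
Qed.

Lemma ma_complE A : ma_compl (pi A) = pi (borel01C A).
Proof.
apply/pi_null_eq; apply: (null_sub _ _ _ (reprY A) (reprY A)); try exact: mY.
exact: setY_setD.
Qed.

Let maP (P : measure_algebra -> Prop) : (forall A, P (pi A)) -> forall x, P x.
Proof. by move=> h x; rewrite -[x]reprK. Qed.

Let ma_meetC : commutative ma_meet.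
Proof.
by elim/maP => A; elim/maP => B; rewrite !ma_meetE; apply: pi_val; exact: setIC.
Qed.

Let ma_joinC : commutative ma_join.
Proof.
by elim/maP => A; elim/maP => B; rewrite !ma_joinE; apply: pi_val; exact: setUC.
Qed.

Let ma_meetA : associative ma_meet.
Proof.
elim/maP => A; elim/maP => B; elim/maP => C.
by rewrite !ma_meetE; apply: pi_val; exact: setIA.
Qed.

Let ma_joinA : associative ma_join.
Proof.
elim/maP => A; elim/maP => B; elim/maP => C.
by rewrite !ma_joinE; apply: pi_val; exact: setUA.
Qed.

Let ma_joinKI y x : ma_meet x (ma_join x y) = x.
Proof.
elim/maP: x => A; elim/maP: y => B.
rewrite ma_joinE ma_meetE; apply: pi_val.
exact: etrans (congr1 _ (setUC _ _)) (setKU _ _).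
Qed.

Let ma_meetKU y x : ma_join x (ma_meet x y) = x.
Proof.
elim/maP: x => A; elim/maP: y => B.
rewrite ma_meetE ma_joinE; apply: pi_val.
exact: etrans (congr1 _ (setIC _ _)) (setKI _ _).
Qed.

Let ma_meetUl : left_distributive ma_meet ma_join.
Proof.
elim/maP => A; elim/maP => B; elim/maP => C.
by rewrite !(ma_joinE, ma_meetE); apply: pi_val; exact: setIUl.
Qed.

Let ma_meetxx : idempotent_op ma_meet.
Proof. by elim/maP => A; rewrite ma_meetE; apply: pi_val; exact: setIid. Qed.

Fact measure_algebra_display : Order.disp_t.
Proof. exact: Order.default_display. Qed.

HB.instance Definition _ := @Order.isMeetJoinDistrLattice.Build
  measure_algebra_display measure_algebra ma_le ma_lt ma_meet ma_join
  (fun _ _ => erefl) (fun _ _ => erefl) ma_meetC ma_joinC ma_meetA ma_joinA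
  ma_joinKI ma_meetKU ma_meetUl ma_meetxx.

Let ma_le0x x : (ma_bot <= x)%O.
Proof.
elim/maP: x => A; apply/eqP; rewrite ma_meetE; apply: pi_val.
exact: set0I.
Qed.

Let ma_lex1 x : (x <= ma_top)%O.
Proof.
elim/maP: x => A; apply/eqP; rewrite ma_meetE; apply: pi_val.
by apply: setIidl; exact: borel01_s.
Qed.

HB.instance Definition _ :=
  Order.hasBottom.Build measure_algebra_display measure_algebra ma_le0x.
HB.instance Definition _ :=
  Order.hasTop.Build measure_algebra_display measure_algebra ma_lex1.

Let ma_joinxC x : (x `|` ma_compl x)%O = (\top)%O.
Proof.
elim/maP: x => A; rewrite ma_complE; rewrite [LHS]ma_joinE; apply: pi_val.
by apply: setDUK; exact: borel01_s.
Qed.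

Let ma_meetxC x : (x `&` ma_compl x)%O = (\bot)%O.
Proof.
elim/maP: x => A; rewrite ma_complE; rewrite [LHS]ma_meetE; apply: pi_val.
exact: setDIK.
Qed.

HB.instance Definition _ := Order.TBDistrLattice_hasComplement.Build
  measure_algebra_display measure_algebra ma_joinxC ma_meetxC.

End measure_algebra.

Section sup_norm.
Context {R : realType} {T : Type}.
Implicit Types f g : T -> R^o.

(* [sup set0 = 0], so this is also right when [T] is empty. *)
Definition sup_norm f : R := sup (range (fun x => `|f x|)).

Definition bounded_function f : Prop := exists M : R, forall x, `|f x| <= M.

Let has_ub f : bounded_function f -> has_ubound (range (fun x => `|f x|)).
Proof. by move=> [M hM]; exists M => _ [x _ <-]. Qed.

Lemma le_sup_norm f x : bounded_function f -> `|f x| <= sup_norm f.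
Proof. by move=> /has_ub h; apply: ub_le_sup => //; exists x. Qed.

Lemma sup_norm_empty f : ~ inhabited T -> sup_norm f = 0.
Proof.
move=> T0; rewrite /sup_norm -[RHS](@sup0 R); congr sup.
by apply/seteqP; split=> // y [x]; have := T0 (inhabits x).
Qed.

Lemma sup_norm_ge0 f : bounded_function f -> 0 <= sup_norm f.
Proof.
move=> bf; have [[x]|T0] := pselect (inhabited T).
  exact: le_trans (normr_ge0 (f x)) (le_sup_norm x bf).
by rewrite sup_norm_empty.
Qed.

Lemma sup_norm_le f M : 0 <= M -> (forall x, `|f x| <= M) -> sup_norm f <= M.
Proof.
move=> M0 fM; have [[x]|T0] := pselect (inhabited T).
  by apply: ge_sup; [exists `|f x|, x | move=> _ [y _ <-]].
by rewrite sup_norm_empty.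
Qed.

Lemma sup_normD f g : bounded_function f -> bounded_function g ->
  sup_norm (f + g) <= sup_norm f + sup_norm g.
Proof.
move=> bf bg; apply: sup_norm_le => [|x].
  by rewrite addr_ge0 ?sup_norm_ge0.
by apply: le_trans (ler_normD _ _) _; rewrite lerD ?le_sup_norm.
Qed.

Lemma sup_normZ (a : R) f : bounded_function f ->
  sup_norm (a *: f) = `|a| * sup_norm f.
Proof.
move=> bf; have bZ b h : bounded_function h ->
    sup_norm (b *: h) <= `|b| * sup_norm h.
  move=> bh; apply: sup_norm_le => [|x]; first by rewrite mulr_ge0 ?sup_norm_ge0.
  by rewrite [`|_|]normrM ler_wpM2l ?le_sup_norm.
apply/eqP; rewrite eq_le bZ//=; have [->|a0] := eqVneq a 0.
  rewrite normr0 mul0r sup_norm_ge0//; exists 0 => x.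
  by rewrite [`|_|]normrM normr0 mul0r.
have {1}-> : f = a^-1 *: (a *: f) by rewrite scalerA mulVf// scale1r.
rewrite -ler_pdivlMl ?normr_gt0// -normfV bZ//.
have [M fM] := bf; exists (`|a| * M) => x.
by rewrite [`|_|]normrM ler_wpM2l.
Qed.

Lemma sup_norm0_eq0 f : bounded_function f -> sup_norm f = 0 -> f = 0.
Proof.
move=> bf f0; apply/funext => x; apply/eqP; rewrite -normr_eq0.
by rewrite eq_le normr_ge0 andbT -f0 le_sup_norm.
Qed.

End sup_norm.

Section continuous_functions.
Context (R : realType) (K : compactHausdorffType).

Definition is_continuous : {pred K -> R^o} := fun f => `[< continuous f >].

Record Cfun : Type := MkCfun {
  Cfun_val :> K -> R^o;
  Cfun_subproof : is_continuous Cfun_val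
}.

HB.instance Definition _ := [isSub for Cfun_val].
HB.instance Definition _ := gen_eqMixin Cfun.
HB.instance Definition _ := gen_choiceMixin Cfun.

Let is_continuous_submod : submod_closed is_continuous.
Proof.
split; first by apply/asboolP => x; exact: cvg_cst.
move=> a f g /asboolP cf /asboolP cg; apply/asboolP => x.
by apply: cvgD; [apply: cvgZr; exact: cf | exact: cg].
Qed.

HB.instance Definition _ :=
  GRing.isSubmodClosed.Build R (K -> R^o) is_continuous is_continuous_submod.
HB.instance Definition _ := [SubChoice_isSubLmodule of Cfun by <:].

Lemma Cfun_continuous (f : Cfun) : continuous f.
Proof. by case: f => f /= /asboolP. Qed.

Lemma Cfun_bounded (f : Cfun) : bounded_function f.
Proof.
have : compact (f @` [set: K]).
  apply: continuous_compact; last exact: compact_setT.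
  by apply: continuous_subspaceT; exact: Cfun_continuous.
move=> /compact_bounded [M [_ /(_ (M + 1))]]; rewrite ltrDl ltr01 => /(_ erefl) h.
by exists (M + 1) => x; apply: h; exists x.
Qed.

Let normD (f g : Cfun) : sup_norm (f + g : Cfun) <= sup_norm f + sup_norm g.
Proof. by apply: sup_normD; exact: Cfun_bounded. Qed.

Let normZ (a : R) (f : Cfun) : sup_norm (a *: f : Cfun) = `|a| * sup_norm f.
Proof. by apply: sup_normZ; exact: Cfun_bounded. Qed.

Let norm0 (f : Cfun) : sup_norm f = 0 -> f = 0.
Proof. by move=> f0; apply/val_inj; apply: sup_norm0_eq0 f0; exact: Cfun_bounded. Qed.

HB.instance Definition _ := Lmodule_isNormed.Build R Cfun normD normZ norm0.

End continuous_functions.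

Section null_sequences.
Context (R : realType).

Definition is_null_sequence : {pred nat -> R^o} :=
  fun u => `[< u @ \oo --> (0 : R^o) >].

Record c0 : Type := MkC0 {
  c0_val :> nat -> R^o;
  c0_subproof : is_null_sequence c0_val
}.

HB.instance Definition _ := [isSub for c0_val].
HB.instance Definition _ := gen_eqMixin c0.
HB.instance Definition _ := gen_choiceMixin c0.

Let is_null_sequence_submod : submod_closed is_null_sequence.
Proof.
split; first by apply/asboolP; exact: cvg_cst.
move=> a u v /asboolP cu /asboolP cv; apply/asboolP.
have h := cvgD (cvgZr (k := a) cu) cv.
rewrite scaler0 addr0 in h; exact: h.
Qed.

HB.instance Definition _ :=
  GRing.isSubmodClosed.Build R (nat -> R^o) is_null_sequence
    is_null_sequence_submod.
HB.instance Definition _ := [SubChoice_isSubLmodule of c0 by <:].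

Lemma c0_cvg (u : c0) : u @ \oo --> (0 : R^o).
Proof. by case: u => u /= /asboolP. Qed.

Lemma c0_bounded (u : c0) : bounded_function u.
Proof.
have /cvg_seq_bounded[M [_ /(_ (M + 1))]] : cvgn u by exact/cvg_ex/(ex_intro _ 0)/c0_cvg.
by rewrite ltrDl ltr01 => /(_ erefl) h; exists (M + 1) => n; exact: h.
Qed.

Let normD (u v : c0) : sup_norm (u + v : c0) <= sup_norm u + sup_norm v.
Proof. by apply: sup_normD; exact: c0_bounded. Qed.

Let normZ (a : R) (u : c0) : sup_norm (a *: u : c0) = `|a| * sup_norm u.
Proof. by apply: sup_normZ; exact: c0_bounded. Qed.

Let norm0 (u : c0) : sup_norm u = 0 -> u = 0.
Proof. by move=> u0; apply/val_inj; apply: sup_norm0_eq0 u0; exact: c0_bounded. Qed.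

HB.instance Definition _ := Lmodule_isNormed.Build R c0 normD normZ norm0.

End null_sequences.

Section complemented.
Context {R : realType}.

Definition bounded_operator (E F : normedModType R) (T : E -> F) : Prop :=
  exists M : R, forall x, `|T x| <= M * `|x|.

(* the second inequality says that the inverse of [T : E -> X] is bounded *)
Definition isomorphic_onto (E F : normedModType R) (X : set F) : Prop :=
  exists T : {linear E -> F},
    [/\ range T = X, bounded_operator T &
        exists M : R, forall x, `|x| <= M * `|T x|].

Definition complemented (F : normedModType R) (X : set F) : Prop :=
  exists P : {linear F -> F},
    [/\ bounded_operator P, forall x, P (P x) = P x & range P = X].

Definition contains_complemented_copy (E F : normedModType R) : Prop :=
  exists X : set F, [/\ closed X, isomorphic_onto E X & complemented X].

End complemented.

(* Main.v *)
(** By transfinite recursion of length omega_1, the measure algebra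
    is embedded into P(omega)/fin: its cardinality is at most that of the
    continuum, so under CH every initial segment of the recursion is countable,
    and an embedding of a countable subalgebra always extends to one further
    element. Let [phi a] be a set of integers representing the image of [a].
    Replacing [phi a] by its copy inside the even integers and adding all odd
    integers when [a] belongs to a fixed ultrafilter [u] gives a new embedding.
    In the associated compactification of omega, whose remainder is the Stone
    space, the odd integers form a sequence of isolated points converging to
    [u]; such a sequence [k n --> p] always gives a complemented copy of c0: the
    functions vanishing off [range k], with projection
    [f |-> (f (k n) - f p)_n]. *)
Require Import Defs.
From HB Require Import structures.
From mathcomp Require Import all_boot all_order all_algebra.
From mathcomp Require Import all_classical all_reals all_analysis.
From mathcomp Require Import measurable_realfun wochoice ring lra.

Set Implicit Arguments.
Unset Strict Implicit.
Unset Printing Implicit Defensive.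

Import Order.Theory GRing.Theory Num.Theory.
Import numFieldNormedType.Exports.

Local Open Scope classical_set_scope.
Local Open Scope card_scope.
(** * Faithful maps into P(omega)/fin *)

Lemma infinite_nat_gt (Y : set nat) (n : nat) :
  infinite_set Y -> exists2 m, Y m & (n < m)%N.
Proof.
move=> Yinf; apply: contrapT => h; apply: Yinf.
apply: (sub_finite_set _ (finite_II n.+1)) => m Ym /=.
by rewrite ltnS leqNgt; apply/negP => nm; apply: h; exists m.
Qed.

(** Infinite sets have members above any bound, so the values can be chosen strictly increasing;
    where [Y n] is finite, the value is only a filler. *)
Lemma injective_choice (Y : nat -> set nat) :
  exists m : nat -> nat,
    injective m /\ forall n, infinite_set (Y n) -> Y n (m n).
Proof.
have next k n : {p | (k < p)%N & infinite_set (Y n) -> Y n p}.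
  apply: cid2; have [/(infinite_nat_gt k)[p Yp kp]|Yfin] := pselect (infinite_set (Y n)).
    by exists p.
  by exists k.+1.
pose fix m n := if n is k.+1 then s2val (next (m k) n) else s2val (next 0 0).
exists m; split=> [|[|n]].
- apply: incn_inj; apply: leq_mono; apply: homo_ltn => [|n] /=.
    exact: ltn_trans.
  by case: (next _ _).
- by rewrite /=; case: (next _ _).
- by rewrite /=; case: (next _ _).
Qed.

Section almost_homomorphisms.
Context {d : Order.disp_t} {B : ctbDistrLatticeType d}.
Implicit Types (a b x y : B) (X Y D : set nat) (S : set (B * set nat)).

Inductive generated S : B -> set nat -> Prop :=
| generated_base x X : S (x, X) -> generated S x X
| generated_top : generated S (\top)%O [set: nat]
| generated_meet x X y Y : generated S x X -> generated S y Y ->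
    generated S (x `&` y)%O (X `&` Y)
| generated_compl x X : generated S x X -> generated S (~` x)%O (~` X).

(* Says that the pairs generated by S form the graph of an injective
   homomorphism from a subalgebra of B to P(omega)/fin. *)
Definition faithful S : Prop :=
  forall x X, generated S x X -> x = (\bot)%O <-> finite_set X.

Lemma generated_sub S S' x X : S `<=` S' -> generated S x X -> generated S' x X.
Proof.
move=> sS; elim=> {x X}; [|exact: generated_top|..].
- by move=> x X /sS; exact: generated_base.
- by move=> *; exact: generated_meet.
- by move=> *; exact: generated_compl.
Qed.

Lemma generated_join S x X y Y : generated S x X -> generated S y Y ->
  generated S (x `|` y)%O (X `|` Y).
Proof.
move=> gx gy; rewrite -[(_ `|` _)%O]complK -[X `|` Y]setCK complU setCU.
by apply/generated_compl/generated_meet; exact: generated_compl.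
Qed.

Lemma generated_bot S : generated S (\bot)%O set0.
Proof. by rewrite -compl1 -setCT; exact/generated_compl/generated_top. Qed.

(** Each generated pair is the value of a finite term, coded by a tree whose leaves are indices in
    an enumeration of [S]. The pair of the top is added to [S] so that an enumeration exists even
    when [S] is empty. *)
Lemma generated_countable S : countable S ->
  countable [set p | generated S p.1 p.2].
Proof.
move=> Sc.
have [e Se] : exists e : nat -> B * set nat, S `<=` range e.
  have : ((\top%O, setT) |` S) #<= [set: nat].
    rewrite (_ : _ |` S = \bigcup_(b in [set: bool])
      if b then [set (\top%O, setT)] else S).
      apply: bigcup_countable => // -[] _; [exact: countable1 | exact: Sc].
    apply/seteqP; split=> p.
      by case=> ?; [exists true | exists false].
    by move=> [[] _] ?; [left | right].
  case/pfcard_geP=> [/seteqP[/(_ (\top%O, setT))]|[e]].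
    by case; left.
  exists e => p Sp; have [n _ <-] := 'surj_e (or_intror Sp : ((\top%O, setT) |` S) p).
  by exists n.
pose fix ev (t : GenTree.tree nat) : B * set nat :=
  match t with
  | GenTree.Leaf n => e n
  | GenTree.Node 0 [:: t] => ((~` (ev t).1)%O, ~` (ev t).2)
  | GenTree.Node _ [:: t; u] =>
     (((ev t).1 `&` (ev u).1)%O, (ev t).2 `&` (ev u).2)
  | _ => (\top%O, setT)
  end.
apply: (@sub_countable _ _ _ (range ev)); last first.
  exact: (sub_countable (card_image_le _ _) (countableP _)).
apply: subset_card_le => -[x X] /=; elim=> {x X}.
- by move=> x X /Se[n _ <-]; exists (GenTree.Leaf n).
- by exists (GenTree.Node 0 [::]).
- move=> x X y Y _ [t _ tE] _ [u _ uE].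
  by exists (GenTree.Node 1 [:: t; u]) => //=; rewrite tE uE.
- by move=> x X _ [t _ tE]; exists (GenTree.Node 0 [:: t]) => //=; rewrite tE.
Qed.

(** The two equivalences are what adjoining [a] with image [D] requires. Countability lists them as
    a sequence of requirements, met by a diagonal construction of [D]. *)
Lemma faithful_extension_countable S a : countable S -> faithful S ->
  exists D : set nat, forall x X, generated S x X ->
    ((x `&` a)%O = (\bot)%O <-> finite_set (X `&` D)) /\
    ((x `&` ~` a)%O = (\bot)%O <-> finite_set (X `\` D)).
Proof.
move=> /generated_countable Gc SF.
have [e eG] : exists e : nat -> B * set nat,
    range e = [set p | generated S p.1 p.2].
  case/pfcard_geP: Gc => [/seteqP[/(_ (\top%O, setT))]|[e]].
    by case; exact: generated_top.
  by exists e; apply/seteqP; split=> [_ [n _ <-]|p /('surj_e)//]; exact: funS.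
have eP i : generated S (e i).1 (e i).2.
  by have : range e (e i) by []; rewrite eG.
have eS x X : generated S x X -> exists i, e i = (x, X).
  move=> g; have : range e (x, X) by rewrite eG.
  by case=> i _ ei; exists i.
(* These unions are themselves images of elements below [b], so removing one from the image of [x]
   keeps an infinite set unless [x] lies below [b]. *)
pose below b n := \bigcup_(i in [set i | (i <= n)%N /\ ((e i).1 <= b)%O]) (e i).2.
have below_gen b n : exists2 u, generated S u (below b n) & (u <= b)%O.
  elim: n => [|n [u gu ub]].
    have [le0|nle0] := boolP ((e 0).1 <= b)%O.
      exists (e 0).1 => //; rewrite (_ : below _ _ = (e 0).2)//.
      apply/seteqP; split=> [p [i []]|p ?]; last by exists 0.
      by rewrite leqn0 => /eqP->.
    exists (\bot)%O => //; rewrite (_ : below _ _ = set0); first exact: generated_bot.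
    apply/seteqP; split=> [p [i []]|p //].
    by rewrite leqn0 => /eqP->; rewrite (negPf nle0).
  have [le0|nle0] := boolP ((e n.+1).1 <= b)%O.
    exists (u `|` (e n.+1).1)%O; last by rewrite leUx ub.
    rewrite (_ : below _ _ = below b n `|` (e n.+1).2); first exact: generated_join.
    apply/seteqP; split=> [p [i []]|p [[i [ib]]|ep]].
    - rewrite leq_eqVlt => /orP[/eqP->|ib] ? ?; [by right|left].
      by exists i.
    - by exists i => //; split => //; exact: leqW.
    - by exists n.+1.
  exists u => //; rewrite (_ : below _ _ = below b n)//.
  apply/seteqP; split=> [p [i []]|p [i [ib]]]; last first.
    by exists i => //; split => //; exact: leqW.
  rewrite leq_eqVlt => /orP[/eqP->|ib ? ?]; first by rewrite (negPf nle0).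
  by exists i.
have disj_fin i u U : generated S u U -> ((e i).1 `&` u)%O = (\bot)%O ->
    finite_set ((e i).2 `&` U).
  by move=> gu h; apply/(SF ((e i).1 `&` u)%O) => //; exact: generated_meet.
(* D is made of the generated sets below [a], and its complement contains those
   below [~` a], up to finite errors. Elements cut by [a] need moreover
   infinitely many points both in and out of D: the points [m n], picked off all
   the constraints among the first [n], are the points to put in
   ([P true]) or to leave out ([P false]). *)
pose c s := if s then (~` a)%O else a.
pose Y i s n := (e i).2 `\` below (c s) n.
pose Z (n : nat) : set nat :=
  if (unpickle n : option (nat * bool * nat)) is Some (i, s, j) then Y i s n
  else [set: nat].
have [m [m_inj mZ]] := injective_choice Z.
pose P (s : bool) := [set p | exists ij : nat * nat,
   let n : nat := pickle (ij.1, s, ij.2) in p = m n /\ Y ij.1 s n p].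
have Pinf i s : ((e i).1 `&` ~` c s)%O <> (\bot)%O -> infinite_set ((e i).2 `&` P s).
  move=> xn0; pose n (j : nat) := pickle (i, s, j).
  have Yinf k : infinite_set (Y i s k).
    have [u gu uc] := below_gen (c s) k.
    have g : generated S ((e i).1 `&` ~` u)%O (Y i s k).
      by rewrite /Y setDE; apply: generated_meet => //; exact: generated_compl.
    move=> /(SF _ _ g) h; apply: xn0; apply/eqP; rewrite -lex0 -h.
    by rewrite leI2// leC.
  have mY j : Y i s (n j) (m (n j)).
    have := mZ (n j); rewrite /Z /n pickleK; exact.
  apply: (@sub_infinite_set _ (range (m \o n))).
    by move=> _ [j _ <-]; have [? ?] := mY j; split=> //; exists (i, j); split=> //; exact: mY.
  have n_inj : injective (m \o n) by move=> j k /m_inj/(pcan_inj pickleK)[].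
  apply/infiniteP; have := inj_card_eq (in2W n_inj : {in [set: nat] &, injective _}).
  by rewrite card_eq_le => /andP[].
(* From stage [i] on, the points of [P s] are chosen outside [below (c s) n], which then contains
   [(e i).2]; only earlier points can lie in it. *)
have Pfin i s : ((e i).1 <= c s)%O -> finite_set ((e i).2 `&` P s).
  move=> ic; apply: (sub_finite_set _ (finite_image m (finite_II i))).
  move=> p [pX [ij /= [pE [_ pB]]]]; exists (pickle (ij.1, s, ij.2)) => //=.
  by rewrite ltnNge; apply/negP => le; apply: pB; exists i.
have Pdisj p : P true p -> ~ P false p.
  by move=> [? [-> _]] [? [/m_inj/(pcan_inj pickleK)]].
(* The trimming leaves [lo] almost disjoint from the image of every element below the complement of
   [a], and costs the image of an element below [a] only finitely many points. *)
pose lo := \bigcup_(n in [set n | ((e n).1 <= a)%O]) ((e n).2 `\` below (~` a)%O n).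
exists (P true `|` lo `\` P false) => x X /eS[i eiE].
rewrite -[x]/(x, X).1 -[X in finite_set (X `&` _)]/(x, X).2.
rewrite -[X in finite_set (X `\` _)]/(x, X).2 -eiE.
split; split.
- move=> /eqP xa; have xc : ((e i).1 <= c true)%O by rewrite -disj_leC.
  apply: (@sub_finite_set _ _ (((e i).2 `&` P true) `|`
    (\bigcup_(n in [set n | (n < i)%N /\ ((e n).1 <= a)%O]) ((e i).2 `&` (e n).2)))).
    move=> p [pX [pP|[[n /= na [pn pb]] _]]]; first by left.
    right; exists n => //; split => //; rewrite ltnNge; apply/negP => le.
    by apply: pb; exists i.
  rewrite finite_setU; split; first exact: Pfin.
  apply: bigcup_finite.
    by apply: (sub_finite_set _ (finite_II i)) => n [].
  move=> n [_ na]; apply: disj_fin (eP n) _; apply/eqP; rewrite -lex0 -(eqP xa).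
  by rewrite leI2.
- apply: contraPP => xa; apply: (@sub_infinite_set _ ((e i).2 `&` P true)).
    by move=> p [? ?]; split=> //; left.
  by apply: Pinf; rewrite /c complK.
- move=> /eqP xa; have xc : ((e i).1 <= a)%O by rewrite -[a]complK -disj_leC.
  have [u gu ua] := below_gen (~` a)%O i.
  apply: (@sub_finite_set _ _ (((e i).2 `&` P false) `|` ((e i).2 `&` below (~` a)%O i))).
    move=> p [pX pD]; have [?|np] := pselect (P false p); first by left.
    right; split=> //; apply: contrapT => pb; apply: pD; right; split=> //.
    by exists i.
  rewrite finite_setU; split; first exact: Pfin.
  apply: disj_fin gu _; apply/eqP; rewrite -lex0 -(eqP xa).
  by rewrite leI2.
- apply: contraPP => xa; apply: (@sub_infinite_set _ ((e i).2 `&` P false)).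
    by move=> p [? pf]; split=> //; case=> [/Pdisj//|[]].
  exact: Pinf.
Qed.

Lemma faithful_extension S a : countable S -> faithful S ->
  exists D : set nat, faithful ((a, D) |` S).
Proof.
move=> Sc SF; have [D DP] := faithful_extension_countable a Sc SF.
exists D => z Z g.
(* Sikorski's normal form for the elements of the extended subalgebra. *)
suff [x [X [y [Y [gx gy zE ZE]]]]] : exists x X y Y,
    [/\ generated S x X, generated S y Y,
        z = ((x `&` a) `|` (y `&` ~` a))%O & Z = (X `&` D) `|` (Y `\` D)].
  have [[xa xf] _] := DP _ _ gx; have [_ [ya yf]] := DP _ _ gy.
  rewrite zE ZE finite_setU; split=> [/eqP|[/xf-> /yf->]]; last by rewrite joinxx.
  by rewrite join_eq0 => /andP[/eqP/xa ? /eqP/ya].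
elim: g => {z Z}.
- move=> z Z [[-> ->]|Sz].
    exists (\top)%O, setT, (\bot)%O, set0; split.
    + exact: generated_top.
    + exact: generated_bot.
    + by rewrite meet1x meet0x joinx0.
    + by rewrite setTI set0D setU0.
  exists z, Z, z, Z; split; [exact: generated_base..| |].
    by rewrite -meetUr joinxC meetx1.
  by rewrite setUIDK.
- exists (\top)%O, setT, (\top)%O, setT; split; [exact: generated_top..| |].
    by rewrite !meet1x joinxC.
  by rewrite setUIDK.
- move=> _ _ _ _ _ [x [X [y [Y [gx gy -> ->]]]]] _ [x' [X' [y' [Y' [gx' gy' -> ->]]]]].
  exists (x `&` x')%O, (X `&` X'), (y `&` y')%O, (Y `&` Y').
  split; [exact: generated_meet..| |].
    rewrite meetUl !meetUr (meetACA x a x') (meetACA x a y').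
    rewrite (meetACA y _ x') (meetACA y _ y') !meetxx.
    by rewrite meetxC meetCx !meetx0 joinx0 join0x.
  by apply/seteqP; split=> p /=; have [?|?] := pselect (D p); tauto.
- move=> _ _ _ [x [X [y [Y [gx gy -> ->]]]]].
  exists (~` x)%O, (~` X), (~` y)%O, (~` Y); split; [exact: generated_compl..| |].
    have cut z : z = ((z `&` a) `|` (z `&` ~` a))%O.
      by rewrite -meetUr joinxC meetx1.
    rewrite [LHS]cut complU !complI complK; congr (_ `|` _)%O.
      rewrite -meetA [((_ `|` a) `&` a)%O]meet_r ?leUr//.
      by rewrite meetUl meetCx joinx0.
    rewrite meetAC [((_ `|` _) `&` ~` a)%O]meet_r ?leUr// meetC.
    by rewrite meetUl meetxC joinx0.
  by apply/seteqP; split=> p /=; have [?|?] := pselect (D p); tauto.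
Qed.

Lemma faithful0 : (\top)%O <> (\bot)%O :> B -> faithful set0.
Proof.
move=> tb x X g.
have [[-> ->]|[-> ->]] : (x = \bot%O /\ X = set0) \/ (x = \top%O /\ X = setT).
  elim: g => {x X} [//||x X y Y _ hx _ hy|x X _ [] [-> ->]]; first by right.
  - case: hx hy => [] [-> ->] => [_|[] [-> ->]].
    + by left; rewrite meet0x set0I.
    + by left; rewrite meetx0 setI0.
    + by right; rewrite meet1x setIT.
  - by right; rewrite compl0 setC0.
  - by left; rewrite compl1 setCT.
- by split.
- by split=> // /infinite_nat.
Qed.

(** A derivation uses finitely many generators, and in a nonempty chain one index bounds them all.
    Faithfulness therefore passes to unions at limit stages. *)
Lemma generated_chain (T : Type) (le : rel T) (F : T -> B * set nat) (A : set T)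
    x X : reflexive le -> transitive le -> total le -> A !=set0 ->
  generated (F @` A) x X ->
  exists2 w, A w & generated (F @` [set y | A y /\ le y w]) x X.
Proof.
move=> lexx letr letot [w0 Aw0].
have mono w w' y Y : le w w' -> generated (F @` [set y | A y /\ le y w]) y Y ->
    generated (F @` [set y | A y /\ le y w']) y Y.
  move=> ww'; apply: generated_sub => _ [z [Az zw] <-]; exists z => //.
  by split=> //; exact: letr zw ww'.
elim=> {x X}.
- move=> x X [w Aw Fw]; exists w => //; apply: generated_base.
  by exists w => //; split.
- by exists w0 => //; exact: generated_top.
- move=> x X y Y _ [w Aw gx] _ [w' Aw' gy].
  have [ww'|w'w] := orP (letot w w').
    by exists w' => //; apply: generated_meet => //; exact: mono gx.
  by exists w => //; apply: generated_meet => //; exact: mono gy.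
- by move=> x X _ [w Aw gx]; exists w => //; exact: generated_compl.
Qed.

End almost_homomorphisms.

(** * Transfinite recursion along a well-order *)

Lemma well_order_total_order (T : eqType) (le : rel T) :
  well_order le -> total_order le.
Proof.
move=> le_wo.
have leC : wo_chain le predT by move=> A _; exact: le_wo.
have letot : total le by move=> x y; exact: (wo_chainW leC).
have lexx : reflexive le by move=> x; exact: (wo_chain_reflexive leC).
have leanti : antisymmetric le by move=> x y; exact: (wo_chain_antisymmetric leC).
have letr : transitive le.
  move=> y x z xy yz.
  have [|m [[mA mlb] _]] := le_wo (mem [set x; y; z]).
    by exists x; rewrite !inE; left; left.
  have {}mlb t : [set x; y; z] t -> le m t by move=> ?; apply: mlb; rewrite !inE.
  have : [set x; y; z] m by rewrite !inE in mA.
  case=> [[]|] mE.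
  - by rewrite -mE; apply: mlb; right.
  - have -> : x = y by apply: leanti; rewrite xy -mE; apply: mlb; left; left.
    by [].
  - have <- : y = z by apply: leanti; rewrite yz -mE; apply: mlb; left; right.
    by [].
by split; [split|].
Qed.

(** At each stage only countably many images have been fixed, so the extension lemma supplies the
    next one. The map [e] may list an element of [B] several times: that lemma covers elements
    already present. *)
Lemma faithful_map_wo d (B : ctbDistrLatticeType d) (T : choiceType)
    (le : rel T) (e : T -> B) (W : set T) :
  (\top)%O <> (\bot)%O :> B -> well_order le ->
  (forall x, W x -> countable [set y | le y x /\ y != x]) ->
  (forall x y, W x -> le y x -> W y) -> W !=set0 ->
  exists D : T -> set nat, faithful ((fun x => (e x, D x)) @` W).
Proof.
move=> tb le_wo Wc Wdown W0.
have [[[lexx letr] leanti] letot] := well_order_total_order le_wo.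
pose lt x y := le x y /\ x != y.
have lt_wf : well_founded lt.
  move=> x; apply: contrapT => nx.
  have [|m [[mA mlb] _]] := le_wo (mem [set y | ~ Acc lt y]).
    by exists x; rewrite inE.
  have {}mA : ~ Acc lt m by rewrite inE in mA.
  apply: mA; constructor=> y [ym yNm]; apply: contrapT => ny.
  by move/eqP: yNm; apply; apply: leanti; rewrite ym mlb// inE.
(* The hypotheses are built into the specification, which makes [next] total: the recursion can be
   run first and shown faithful afterwards. *)
pose good x D S := countable S -> faithful S -> faithful ((e x, D) |` S).
have [next nextP] : exists next, forall x S, good x (next x S) S.
  have h (p : T * set (B * set nat)) : exists D, good p.1 D p.2.
    have [[c f]|nS] := pselect (countable p.2 /\ faithful p.2).
      by have [D] := faithful_extension (e p.1) c f; exists D.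
    by exists set0 => c f; case: nS.
  have [f fP] := choice h; exists (fun x S => f (x, S)) => x S; exact: fP (x, S).
pose step x (rec : forall y, lt y x -> set nat) :=
  next x [set p | exists y (yx : lt y x), p = (e y, rec y yx)].
pose D := Fix lt_wf (fun=> set nat) step.
have DE x : D x = next x ((fun y => (e y, D y)) @` [set y | lt y x]).
  rewrite /D Fix_eq => [|{}x f g fg]; last first.
    by congr (next _ _); apply/seteqP; split=> p [y [yx ->]]; exists y, yx; rewrite fg.
  congr (next _ _); apply/seteqP; split=> p; first by move=> [y [yx ->]]; exists y.
  by move=> [y yx <-]; exists y, yx.
pose F x := (e x, D x).
have main x : W x -> faithful (F @` [set y | le y x]).
  elim/(well_founded_ind lt_wf): x => x IH Wx.
  have -> : F @` [set y | le y x] = F x |` (F @` [set y | lt y x]).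
    apply/seteqP; split=> [_ [y yx <-]|_ [->|[y [yx _] <-]]].
    - have [->|yNx] := eqVneq y x; [by left|right].
      by exists y.
    - by exists x => //=.
    - by exists y.
  rewrite {1}/F DE; apply: nextP.
    exact: (sub_countable (card_image_le _ _) (Wc _ Wx)).
  have [ne|/set0P/negP/negPn/eqP->] := pselect ([set y | lt y x] !=set0); last first.
    by rewrite image_set0; exact: faithful0.
  (* Successor and limit stages are treated alike: a pair generated strictly before [x] is generated
     up to some [w] before [x]. *)
  move=> z Z /(generated_chain lexx letr letot ne)[w wx g].
  apply: (IH w wx); first by apply: Wdown Wx _; case: wx.
  by apply: generated_sub g => _ [y [_ yw] <-]; exists y.
exists D => z Z /(generated_chain lexx letr letot W0)[w Ww g].
by apply: (main w Ww); apply: generated_sub g => _ [y [_ yw] <-]; exists y.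
Qed.

(** * The compactification of omega given by an almost homomorphism *)

Lemma finite_nat_bounded (X : set nat) :
  finite_set X -> exists N, forall n, X n -> (n < N)%N.
Proof.
move=> /finite_seqP[s ->]; exists (\max_(i <- s) i).+1 => n /= ns.
by rewrite ltnS; exact: (@leq_bigmax_seq _ s xpredT id).
Qed.

Section ultrafilters.
Context {d : Order.disp_t} {B : ctbDistrLatticeType d}.
Implicit Types (a b c : B) (u v : stone B).

Lemma stone_ultrafilter u : ultrafilter (set_val u).
Proof. exact: set_valP. Qed.

Lemma stone_proper u : proper_filter (set_val u).
Proof. by have [] := stone_ultrafilter u. Qed.

Lemma proper_filter_compl (F : set B) a : proper_filter F -> F a -> ~ F (~` a)%O.
Proof. by move=> [_ F0 FI _] Fa /(FI _ _ Fa); rewrite meetxC. Qed.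

(** If [a] is not in [u], the filter generated by [u] and the complement of [a] is proper, hence
    equals [u] by maximality. *)
Lemma stone_prime u a : set_val u a \/ set_val u (~` a)%O.
Proof.
have [[ut u0 uI uS] umax] := stone_ultrafilter u.
have [ua|nua] := pselect (set_val u a); [by left|right].
pose G := [set b | exists2 c, set_val u c & (c `&` ~` a <= b)%O].
suff <- : G = set_val u by exists (\top)%O => //; rewrite meet1x.
apply: umax => [|c uc]; last by exists c => //; rewrite leIl.
split.
- by exists (\top)%O; rewrite ?lex1.
- by case=> c uc; rewrite lex0 disj_leC complK => ca; apply: nua; exact: uS uc.
- move=> b b' [c uc cb] [c' uc' cb']; exists (c `&` c')%O; first exact: uI.
  by rewrite lexI (le_trans _ cb) ?(le_trans _ cb')// leI2// ?leIl ?leIr.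
- by move=> b b' bb' [c uc cb]; exists c => //; exact: le_trans bb'.
Qed.

Lemma prime_ultrafilter (F : set B) : proper_filter F ->
  (forall a, F a \/ F (~` a)%O) -> ultrafilter F.
Proof.
move=> pF prF; split=> // G pG FG; apply/seteqP; split=> // a Ga.
by have [//|/FG Gna] := prF a; case: (proper_filter_compl pG Ga).
Qed.

Lemma stone_separate u v : u <> v -> exists2 a, set_val u a & set_val v (~` a)%O.
Proof.
move=> uv; apply: contrapT => h; apply: uv; apply: val_inj => /=.
have [_ umax] := stone_ultrafilter u; apply/esym/umax; first exact: stone_proper.
move=> a ua; have [//|va] := stone_prime v a.
by exfalso; apply: h; exists a.
Qed.

Lemma open_stone_base a : open (stone_base a).
Proof.
exists [set stone_base a]; last by rewrite bigcup_set1.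
by move=> _ ->; exists a.
Qed.

Lemma open_stoneP (O : set (stone B)) : open O <->
  forall u, O u -> exists2 a, set_val u a & stone_base a `<=` O.
Proof.
split=> [[D DB <-] u [U DU Uu]|h].
  have [a _ aU] := DB _ DU; subst U; exists a => // v va.
  by exists (stone_base a).
rewrite openE => u /h[a ua aO]; apply: filterS aO _.
by apply: open_nbhs_nbhs; split => //; exact: open_stone_base.
Qed.

End ultrafilters.

(** These are representatives of an injective Boolean homomorphism into P(omega)/fin. [almost_meet]
    covers monotonicity ([a = b]) and meets ([c] their meet) at once. *)
Record almost_morphism {d} (B : ctbDistrLatticeType d) := AlmostMorphism {
  almost_fun :> B -> set nat;
  almost_meet : forall a b c, (a `&` b <= c)%O ->
    finite_set ((almost_fun a `&` almost_fun b) `\` almost_fun c);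
  almost_compl : forall a, finite_set (~` (almost_fun a `|` almost_fun (~` a)%O));
  almost_bot : finite_set (almost_fun (\bot)%O);
  almost_infinite : forall a, a <> (\bot)%O -> infinite_set (almost_fun a)
}.

(** Keeping [phi] in the type lets every morphism put its own topology on the same points. *)
Definition gamma {d} {B : ctbDistrLatticeType d} (phi : almost_morphism B) : Type :=
  (nat + stone B)%type.

Section compactification.
Context {d : Order.disp_t} {B : ctbDistrLatticeType d} (phi : almost_morphism B).
Implicit Types (a b : B) (u v : stone B) (n m : nat).
Local Notation gamma := (gamma phi).

HB.instance Definition _ := Choice.copy gamma (nat + stone B)%type.

(* The integers are isolated, and the neighbourhoods of an ultrafilter contain,
   for some [a] in it, almost all of [phi a]. *)
Definition gamma_open (U : set gamma) := forall u, U (inr u) ->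
  exists a, [/\ set_val u a, stone_base a `<=` [set v | U (inr v)] &
                finite_set (phi a `\` [set n | U (inl n)])].

Let gamma_openT : gamma_open setT.
Proof.
move=> u _; exists (\top)%O; split => //; first by case: (stone_proper u).
by rewrite setDT.
Qed.

Let gamma_openI : setI_closed gamma_open.
Proof.
move=> U V oU oV u [/oU[a [ua aU fa]] /oV[b [ub bV fb]]].
have [_ _ uI _] := stone_proper u; exists (a `&` b)%O; split; first exact: uI.
  move=> v /= vab; have [_ _ _ vS] := stone_proper v.
  by split; [apply: aU | apply: bV]; apply: vS vab; [exact: leIl | exact: leIr].
have fab c : (a `&` b <= c)%O -> finite_set (phi (a `&` b)%O `\` phi c).
  move=> abc; have := @almost_meet _ _ phi (a `&` b)%O (a `&` b)%O c.
  by rewrite meetxx setIid; exact.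
have h := fab a (leIl _ _); have h' := fab b (leIr _ _).
apply: (@sub_finite_set _ _ (((phi (a `&` b)%O `\` phi a) `|` (phi a `\` [set n | U (inl n)]))
 `|` ((phi (a `&` b)%O `\` phi b) `|` (phi b `\` [set n | V (inl n)])))).
  move=> n [pn UVn]; have [an|] := pselect (phi a n); last by left; left.
  have [bn|] := pselect (phi b n); last by right; left.
  have [Un|] := pselect (U (inl n)); last by left; right.
  by right; right; split => // Vn; exact: UVn.
by rewrite !finite_setU.
Qed.

Let gamma_open_bigU (I : Type) (f : I -> set gamma) :
  (forall i, gamma_open (f i)) -> gamma_open (\bigcup_i f i).
Proof.
move=> of_ u [i _ /of_[a [ua af fa]]]; exists a; split => //.
  by move=> v /af; exists i.
by apply: sub_finite_set fa => n [pn nf]; split => // fn; apply: nf; exists i.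
Qed.

HB.instance Definition _ :=
  isOpenTopological.Build gamma gamma_openT gamma_openI gamma_open_bigU.

Lemma gamma_openE (U : set gamma) : open U = gamma_open U.
Proof. by []. Qed.

Lemma open_gamma_inl (X : set nat) : open ([set inl n | n in X] : set gamma).
Proof. by rewrite gamma_openE => u []. Qed.

Definition gamma_base a : set gamma :=
  [set p | match p with inl n => phi a n | inr u => set_val u a end].

Lemma open_gamma_base a : open (gamma_base a).
Proof. by rewrite gamma_openE => u ua; exists a; split => //; rewrite setDv. Qed.

Lemma open_gamma_cofinite (X : set nat) : finite_set X ->
  open (~` [set inl n | n in X] : set gamma).
Proof.
move=> fX; rewrite gamma_openE => u _; exists (\top)%O; split.
- by case: (stone_proper u).
- by move=> v _ [].
- by apply: sub_finite_set fX => n [_ /contrapT[m Xm [<-]]].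
Qed.

Let gamma_hausdorff : hausdorff_space gamma.
Proof.
rewrite open_hausdorff => p q pq.
have sep n (r : gamma) : inl n != r -> exists2 UV : set gamma * set gamma,
    UV.1 (inl n) /\ UV.2 r & [/\ open UV.1, open UV.2 & UV.1 `&` UV.2 = set0].
  move=> nr; exists ([set inl m | m in [set n]], ~` [set inl m | m in [set n]]) => /=.
    by split; [exists n | move=> [_ -> nrE]; rewrite nrE eqxx in nr].
  split; [exact: open_gamma_inl | exact: open_gamma_cofinite | exact: setICr].
case: p q pq => [n|u] [m|v] pq.
- by have [[U V] /= [? ?] ?] := sep n _ pq; exists (U, V) => //=; rewrite !inE.
- by have [[U V] /= [? ?] ?] := sep n _ pq; exists (U, V) => //=; rewrite !inE.
- rewrite eq_sym in pq; have [[U V] /= [? ?] [? ? UV0]] := sep m _ pq.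
  by exists (V, U) => /=; rewrite ?inE//; split=> //; rewrite setIC.
- have [|a ua va] := @stone_separate _ _ u v.
    by move=> uv; rewrite uv eqxx in pq.
  (* The basic sets of [a] and its complement share at most finitely many integers, so the second
     stays open when the first is removed. *)
  exists (gamma_base a, gamma_base (~` a)%O `\` gamma_base a) => /=.
    rewrite !inE; split => //; split => //.
    exact: (proper_filter_compl (stone_proper v) ^~ va).
  split; first exact: open_gamma_base; last first.
    by rewrite setDE setICA setICr setI0.
  rewrite gamma_openE => w [/= wa nwa]; exists (~` a)%O; split => //.
    by move=> x xa; split => //= /(proper_filter_compl (stone_proper x)).
  have h := @almost_meet _ _ phi a (~` a)%O \bot%O.
  rewrite meetxC lexx in h; have {}h := h isT.
  apply: (@sub_finite_set _ _ ((phi a `&` phi (~` a)%O `\` phi \bot%O) `|` phi \bot%O)).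
    move=> n [na h']; have [pa|npa] := pselect (phi a n); last by exfalso; apply: h'.
    by have [?|?] := pselect (phi \bot%O n); [right|left].
  by rewrite finite_setU; split => //; exact: almost_bot.
Qed.

(** An ultrafilter [F] either concentrates on an integer or converges to the ultrafilter of those
    [a] with [gamma_base a] in [F]. In the second case [F] avoids every finite set of integers, so
    the finite errors of [phi] disappear. *)
Let gamma_compact : compact [set: gamma].
Proof.
rewrite compact_ultra => F FU _.
have [[n Fn]|Fnp] := pselect (exists n, F [set inl n]).
  exists (inl n); split=> // A /nbhs_singleton An.
  by apply: filterS Fn => _ ->.
have Fcof X : finite_set X -> F (~` [set inl n | n in X]).
  move=> /finite_nat_bounded[N XN].
  suff : F (~` [set inl n | n in `I_N]).
    by apply: filterS => p h [n /XN nN np]; apply: h; exists n.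
  elim: N {XN} => [|N IH].
    by rewrite (_ : ~` _ = setT); [exact: filterT | rewrite -subTset => p _ []].
  have [FN|FN] := in_ultra_setVsetC [set inl N] FU; first by exfalso; apply: Fnp; exists N.
  apply: filterS (filterI IH FN) => p [h pN] [n /=].
  rewrite ltnS leq_eqVlt => /orP[/eqP nN np|nN np]; last by apply: h; exists n.
  by apply: pN; rewrite -np nN.
pose u := [set a | F (gamma_base a)].
have uI a b c : (a `&` b <= c)%O -> u a -> u b -> u c.
  move=> abc ua ub; have /Fcof Fc := almost_meet phi abc.
  apply: filterS (filterI (filterI ua ub) Fc) => -[n [[pa pb] h]|v [[va vb] _]] /=.
    by apply: contrapT => npc; apply: h; exists n.
  by have [_ _ vI vS] := stone_proper v; apply: vS abc (vI _ _ va vb).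
have ubot : ~ u (\bot)%O.
  have /Fcof F0 := almost_bot phi; move=> /(filterI F0) h.
  have PF : ProperFilter F by apply: ultra_proper.
  suff : F set0 by exact: filter_not_empty.
  apply: filterS h => -[n [h pn]|v [_ v0]].
    by apply: h; exists n.
  by case: (stone_proper v).
have uprime a : u a \/ u (~` a)%O.
  have [|Fa] := in_ultra_setVsetC (gamma_base a) FU; [by left|right].
  have /Fcof Fc := almost_compl phi a.
  apply: filterS (filterI Fc Fa) => -[n [h na]|v [_ na]] /=.
    by apply: contrapT => npc; apply: h; exists n => // -[].
  by have [] := stone_prime v a.
have uultra : ultrafilter u.
  apply: prime_ultrafilter => //; split=> //.
  - by have [//|] := uprime (\top)%O; rewrite compl1.
  - by move=> a b ua ub; exact: uI ua ub.
  - by move=> a b ab ua; apply: (uI _ _ _ _ ua ua); rewrite meetxx.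
exists (inr (exist _ u (mem_set uultra))); split=> // A.
rewrite /= nbhsE => -[U [oU Uu] UA].
have [a [ua aU /Fcof Fa]] := oU _ Uu.
apply: filterS (filterI ua Fa) => -[n [na h]|v [va _]]; apply: UA.
  by apply: contrapT => nU; apply: h; exists n.
exact: aU.
Qed.

HB.instance Definition _ :=
  isCompactHausdorff.Build gamma gamma_compact gamma_hausdorff.

Definition gamma_inl (n : nat) : gamma := inl n.

Lemma gamma_compactification : is_compactification gamma_inl.
Proof.
split; last first.
  (* A neighbourhood of [u] contains almost all of some [phi a] with [a] in [u], an infinite set
     because [a] is nonzero. *)
  move=> O [[n|u] Op] oO; first by exists (inl n); split => //; exists n.
  have [a [ua aO fa]] := oO _ Op.
  have a0 : a <> (\bot)%O by move=> a0; rewrite a0 in ua; case: (stone_proper u).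
  have [n [pn On]] : (phi a `&` [set n | O (inl n)]) !=set0.
    apply/set0P/negP => /eqP h; apply: (@almost_infinite _ _ phi _ a0).
    apply: sub_finite_set fa => n pn; split => // On.
    by have : (set0 : set nat) n by rewrite -h.
  by exists (inl n); split => //; exists n.
pose h n : range gamma_inl := exist _ (gamma_inl n) (mem_set (imageT _ _)).
pose g (p : range gamma_inl) := if set_val p is inl n then n else 0.
have gP p : gamma_inl (g p) = set_val p.
  have : range gamma_inl (set_val p) by exact: set_valP.
  by rewrite /g; case: (set_val p) => [//|u [n]].
exists h => //; exists g; split.
- by [].
- by move=> p; apply: val_inj; exact: gP.
- by apply/continuousP => A _; exact: discrete_open.
- apply/continuousP => A _.
  exists ([set inl n | n in A] : set gamma); first exact: open_gamma_inl.
  apply/seteqP; split => p; last by exists (g p) => //; exact: gP.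
  by case=> m Am; rewrite -[X in _ = X]gP /= => -[<-].
Qed.

Lemma gamma_remainder : homeomorphic (~` range gamma_inl) (stone B).
Proof.
have ex (p : ~` range gamma_inl) : exists u, set_val p = inr u.
  have : (~` range gamma_inl) (set_val p) by exact: set_valP.
  case: (set_val p) => [n nr|u _]; last by exists u.
  by exfalso; apply: nr; exists n.
have [f fE] := choice ex.
have inrP u : (~` range gamma_inl) (inr u) by case.
pose g u : ~` range gamma_inl := exist _ (inr u) (mem_set (inrP u)).
exists f; exists g; split.
- by move=> p; apply: val_inj; exact: esym (fE p).
- by move=> u; have := fE (g u); case.
- apply/continuousP => O /open_stoneP oO.
  (* Adding every integer to [O] makes the finiteness condition of [gamma_open] automatic. *)
  exists ([set p | if p is inr u then O u else True] : set gamma).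
    move=> u /oO[a ua aO]; exists a; split => //.
    by rewrite (_ : _ `\` _ = set0)//; apply/seteqP; split=> n // [_]; apply.
  have OfE p : (if set_val p is inr u then O u else True) = O (f p) by rewrite fE.
  by apply/funext => p; exact: OfE.
- apply/continuousP => _ [U oU <-]; apply/open_stoneP => u /= Uu.
  by have [a [ua aU _]] := oU u Uu; exists a.
Qed.

End compactification.

(** * Faithful maps under the continuum hypothesis *)

Lemma uncountable_real (R : realType) : ~ countable [set: R].
Proof.
move=> /(sub_countable (subset_card_le (@subsetT _ `[0%R, 1%R]%classic))).
move=> /countable_lebesgue_measure0/eqP.
by rewrite lebesgue_measure_itv /= lte_fin ltr01 oppr0 adde0 eqe oner_eq0.
Qed.

(** By CH the uncountable [W] has the size of the reals and so surjects onto [B], while its initial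
    segments are countable, as [faithful_map_wo] asks. *)
Lemma faithful_map (R : realType) (CH : continuum_hypothesis R)
    d (B : ctbDistrLatticeType d) (f : B -> R) :
  injective f -> (\top)%O <> (\bot)%O :> B ->
  exists phi : B -> set nat, faithful (range (fun b => (b, phi b))).
Proof.
move=> f_inj tb; have [le le_wo] := well_ordering_principle R.
have [[[lexx letr] leanti] letot] := well_order_total_order le_wo.
(* Either W is all of R, or it is the least uncountable initial segment. *)
pose W := [set x : R | countable [set y | le y x /\ y != x]].
have Wdown x y : W x -> le y x -> W y.
  move=> Wx yx; apply: sub_countable Wx; apply: subset_card_le => z [zy zNy].
  split; first exact: letr zy yx.
  by apply: contraNneq zNy => zx; apply/eqP/leanti; rewrite zy zx yx.
have Wunc : ~ countable W.
  (* If [W] is countable and not everything, the predecessors of the least [m] outside it all lie in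
     [W], so they are countable and [m] is in [W]. *)
  move=> Wc; have [WT|nW] := pselect (forall x, W x).
    apply: (@uncountable_real R); rewrite (_ : setT = W)//.
    by apply/esym; rewrite -subTset => x _; exact: WT.
  have [|m [[mW mlb] _]] := le_wo (mem (~` W)).
    apply: contrapT => h; apply: nW => x; apply: contrapT => nx; apply: h.
    by exists x; rewrite inE.
  have {}mW : ~ W m by rewrite inE in mW.
  apply: mW; apply: sub_countable Wc; apply: subset_card_le => y [ym yNm].
  apply: contrapT => nWy; move/eqP: yNm; apply; apply: leanti.
  by rewrite ym mlb// inE.
have BW : [set: B] #<= W.
  have [//|/card_esym RW] := CH W.
  have fB := inj_card_eq (in2W f_inj : {in [set: B] &, injective f}).
  have /card_eqPle[_ Bf] := fB.
  have /card_eqPle[RW' _] := RW.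
  exact: card_le_trans Bf (card_le_trans (card_leT _) RW').
case/pfcard_geP: BW => [/seteqP[/(_ \top%O)]|[e]]; first by case.
have [|D DF] := faithful_map_wo (W := W) e tb le_wo (fun x Wx => Wx) Wdown.
  by have [x Wx _] := 'surj_e (I : [set: B] \top%O); exists x.
have ex b : exists x, W x /\ e x = b.
  by have [x Wx xb] := 'surj_e (I : [set: B] b); exists x.
have [s sP] := choice ex; exists (D \o s) => x X g; apply: (DF x X).
apply: generated_sub g => _ [b _ <-]; have [Ws sb] := sP b.
by exists (s b) => //; rewrite sb.
Qed.

Section faithful_almost_morphism.
Context {d : Order.disp_t} {B : ctbDistrLatticeType d} (phi : B -> set nat).
Context (phiF : faithful (range (fun b => (b, phi b)))).
Implicit Types a b c : B.

Let gen a : generated (range (fun b => (b, phi b))) a (phi a).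
Proof. by apply: generated_base; exists a. Qed.

Let phi_meet a b c : (a `&` b <= c)%O -> finite_set ((phi a `&` phi b) `\` phi c).
Proof.
move=> abc; have {}abc : (a `&` b `&` ~` c)%O = (\bot)%O.
  by apply/eqP; rewrite disj_leC complK.
rewrite setDE.
exact/(phiF (generated_meet (generated_meet (gen a) (gen b)) (generated_compl (gen c)))).
Qed.

Let phi_compl a : finite_set (~` (phi a `|` phi (~` a)%O)).
Proof.
apply/(phiF (generated_compl (generated_join (gen a) (gen (~` a)%O)))).
by rewrite joinxC compl1.
Qed.

Let phi_bot : finite_set (phi (\bot)%O).
Proof. exact/(phiF (gen _)). Qed.

Let phi_infinite a : a <> (\bot)%O -> infinite_set (phi a).
Proof. by move=> a0 /(phiF (gen a)). Qed.

Definition almost_of_faithful : almost_morphism B :=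
  AlmostMorphism phi_meet phi_compl phi_bot phi_infinite.

End faithful_almost_morphism.

(** * A sequence of isolated points converging to an ultrafilter *)

Section convergent_sequence.
Context {d : Order.disp_t} {B : ctbDistrLatticeType d}.
Implicit Types (phi : almost_morphism B) (u : stone B) (a b c : B).

(** Compactness of [gamma phi] gives the sequence of integers a cluster point, and an isolated
    integer cannot be one. *)
Lemma stone_inhabited phi : inhabited (stone B).
Proof.
have [] := @compact_setT (gamma phi) ((@gamma_inl _ _ phi) @ \oo).
  by exact: filterT.
case=> [n|u] [_ clu]; last exact: (inhabits u).
have [| |x [h [m mn mx]]] := clu (~` [set inl m | m in `I_n.+1]) [set inl m | m in [set n]].
- by exists n.+1 => // m /= nm [k /= kn [km]]; rewrite km ltnNge nm in kn.
- by apply: open_nbhs_nbhs; split; [exact: open_gamma_inl | exists n].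
- by exfalso; apply: h; exists m => //=; rewrite mn.
Qed.

Section interleave.
Context phi u.

Let psi a : set nat :=
  [set n | if odd n then set_val u a else phi a n./2].

(** At odd integers the finiteness conditions on [psi] hold without exception, since [u] is an
    ultrafilter; the exceptions are doubles of those for [phi]. *)
Let finite_even (X Y : set nat) : finite_set X ->
  (forall n, Y n -> ~~ odd n /\ X n./2) -> finite_set Y.
Proof.
move=> fX YX; apply: sub_finite_set (finite_image double fX) => n /YX[nodd Xn].
by exists n./2 => //; rewrite even_halfK.
Qed.

Let psi_meet a b c : (a `&` b <= c)%O -> finite_set ((psi a `&` psi b) `\` psi c).
Proof.
move=> abc; apply: finite_even (almost_meet phi abc) _ => n.
rewrite /psi /=; case: (odd n) => // -[[ua ub] []].
by have [_ _ uI uS] := stone_proper u; exact: uS abc (uI _ _ ua ub).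
Qed.

Let psi_compl a : finite_set (~` (psi a `|` psi (~` a)%O)).
Proof.
apply: finite_even (almost_compl phi a) _ => n.
by rewrite /psi /=; case: (odd n) => // -[]; exact: stone_prime.
Qed.

Let psi_bot : finite_set (psi (\bot)%O).
Proof.
apply: finite_even (almost_bot phi) _ => n.
by rewrite /psi /=; case: (odd n) => //; case: (stone_proper u).
Qed.

Let psi_infinite a : a <> (\bot)%O -> infinite_set (psi a).
Proof.
move=> a0; apply: contra_not (@almost_infinite _ _ phi _ a0) => fpsi.
apply: sub_finite_set (finite_image half fpsi) => n pn.
by exists n.*2; rewrite ?doubleK// /psi /= odd_double doubleK.
Qed.

Definition interleave : almost_morphism B :=
  AlmostMorphism psi_meet psi_compl psi_bot psi_infinite.

Lemma interleave_cvg :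
  (fun n => inl n.*2.+1 : gamma interleave) @ \oo --> (inr u : gamma interleave).
Proof.
move=> A; rewrite nbhsE => -[U [oU Uu] UA].
have [a [ua _ /finite_nat_bounded[N aN]]] := oU _ Uu.
exists N => // n /= Nn; apply: UA; apply: contrapT => nU.
(* Every odd integer lies in [interleave a] because [a] belongs to [u]. *)
have /aN : (interleave a `\` [set n | U (inl n)]) n.*2.+1.
  by split => //=; rewrite /psi /= odd_double.
by rewrite ltnNge (leq_trans Nn)// -addnn -addnS leq_addr.
Qed.

End interleave.
End convergent_sequence.

Local Open Scope ring_scope.

(** * Complemented copies of c0 *)

Section complemented_c0.
Context (R : realType) (K : compactHausdorffType) (k : nat -> K) (p : K).
Context (k_inj : injective k) (k_open : forall n, open [set k n]).
Context (k_cvg : k @ \oo --> p).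

Let index_ex : exists g : K -> option nat, forall q n, g q = Some n <-> k n = q.
Proof.
have ex q : exists o : option nat, forall n, o = Some n <-> k n = q.
  have [[n <-]|nk] := pselect (exists n, k n = q).
    by exists (Some n) => m; split=> [[->]|/k_inj->].
  by exists None => n; split=> // kn; exfalso; apply: nk; exists n.
by have [g gP] := choice ex; exists g.
Qed.

Let index : K -> option nat := sval (cid index_ex).

Let indexP q n : index q = Some n <-> k n = q.
Proof. exact: (svalP (cid index_ex)). Qed.

Let index_k n : index (k n) = Some n.
Proof. exact/indexP. Qed.

Definition extend0 (x : nat -> R^o) (q : K) : R^o :=
  if index q is Some n then x n else 0.

Lemma extend0_k x n : extend0 x (k n) = x n.
Proof. by rewrite /extend0 index_k. Qed.

Lemma extend0_le x (M : R) q : 0 <= M -> (forall n, `|x n| <= M) ->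
  `|extend0 x q| <= M.
Proof. by move=> M0 xM; rewrite /extend0; case: (index q) => //; rewrite normr0. Qed.

(** The points [k n] are isolated. Around any other point the finitely many [k n] with [n < N] can
    be avoided, and [x] is small at the remaining indices. *)
Lemma extend0_continuous (x : c0 R) : continuous (extend0 x).
Proof.
move=> q; case qE : (index q) => [n|].
  have <- : k n = q by exact/indexP.
  move=> A /nbhs_singleton Ax; rewrite /= nbhsE; exists [set k n] => //.
  by move=> _ ->.
have q0 : extend0 x q = 0 by rewrite /extend0 qE.
apply/cvgrPdist_lt => e e0.
have /cvgrPdist_lt/(_ e e0)[N _ xN] := c0_cvg x.
have : nbhs q (~` (k @` `I_N)).
  apply: open_nbhs_nbhs; split.
    rewrite openC; move: (k @` _) (finite_image k (finite_II N)).
    exact/accessible_finite_set_closed/hausdorff_accessible/hausdorff_setT.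
  by move=> [n _ /indexP]; rewrite qE.
apply: filterS => r rk; rewrite q0 /extend0; case rE : (index r) => [n|].
  apply: xN => /=; rewrite leqNgt; apply/negP => nN; apply: rk.
  by exists n => //; exact/indexP.
by rewrite subrr normr0.
Qed.

Definition c0_embed (x : c0 R) : Cfun R K := MkCfun (asboolT (@extend0_continuous x)).

Lemma c0_embed_linear : linear c0_embed.
Proof.
move=> a x y; apply: val_inj; apply/funext => q.
rewrite [LHS]/= [RHS]/(a * extend0 x q + extend0 y q) /extend0.
by case: (index q) => [n //|]; rewrite mulr0; exact/esym/addr0.
Qed.

Lemma c0_restrict_cvg (f : Cfun R K) :
  (fun n => f (k n) - f p : R^o) @ \oo --> (0 : R^o).
Proof.
rewrite -[X in _ --> X](subrr (f p : R^o)); apply: cvgB; last exact: cvg_cst.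
by apply: cvg_comp k_cvg _; exact: Cfun_continuous.
Qed.

Definition c0_restrict (f : Cfun R K) : c0 R := MkC0 (asboolT (c0_restrict_cvg f)).

Lemma c0_restrict_linear : linear c0_restrict.
Proof.
move=> a f g; apply: val_inj; apply/funext => n.
have E (b c b' c' : R) : a * b + c - (a * b' + c') = a * (b - b') + (c - c').
  by ring.
exact: E.
Qed.

Lemma c0_embed_norm x : `|c0_embed x| = `|x|.
Proof.
apply/eqP; rewrite eq_le; apply/andP; split.
  apply: sup_norm_le => [|q]; first exact: normr_ge0.
  apply: extend0_le => [|n]; first exact: normr_ge0.
  exact/le_sup_norm/c0_bounded.
apply: sup_norm_le => [|n]; first exact: normr_ge0.
rewrite -extend0_k; apply: (@le_sup_norm _ _ (c0_embed x) (k n)).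
exact: Cfun_bounded.
Qed.

Lemma c0_restrict_norm f : `|c0_restrict f| <= 2 * `|f|.
Proof.
have f_le q : `|f q| <= `|f| by apply: (@le_sup_norm _ _ f q); exact: Cfun_bounded.
apply: sup_norm_le => [|n]; first by rewrite mulr_ge0.
by rewrite (le_trans (ler_normB _ _))// mulrDl mul1r lerD.
Qed.

(** The extension vanishes at [p]: by continuity its value there is the limit of [x]. Subtracting it
    therefore changes nothing. *)
Lemma c0_embedK : cancel c0_embed c0_restrict.
Proof.
move=> x; apply: val_inj; apply/funext => n /=.
have : (fun n => extend0 x (k n)) @ \oo --> extend0 x p.
  by apply: cvg_comp k_cvg _; exact: extend0_continuous.
under eq_fun do rewrite extend0_k.
move=> /(cvg_unique (@Rhausdorff R) (@c0_cvg _ x)) <-.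
by rewrite extend0_k subr0.
Qed.

Lemma complemented_c0_cvg : contains_complemented_copy (c0 R) (Cfun R K).
Proof.
pose T : {linear c0 R -> Cfun R K} :=
  HB.pack c0_embed (GRing.isLinear.Build _ _ _ _ _ c0_embed_linear).
pose Q : {linear Cfun R K -> c0 R} :=
  HB.pack c0_restrict (GRing.isLinear.Build _ _ _ _ _ c0_restrict_linear).
pose P : {linear Cfun R K -> Cfun R K} := T \o Q.
have PT x : P (T x) = T x by rewrite /P /= c0_embedK.
have P_le f : `|P f| <= 2 * `|f|.
  by rewrite /P /= c0_embed_norm c0_restrict_norm.
exists (range T); split.
(* A bounded [P] fixing its range makes the range closed: if [T x] is within [e / 3] of [f], then
   [P f] is within [e] of [f], the factor 3 being 2 + 1. *)
- move=> f cf; exists (Q f) => //; apply/eqP; rewrite -subr_eq0 -normr_le0.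
  apply/ler_addgt0Pl => e e0; rewrite addr0.
  have e3 : 0 < e / 3 by rewrite divr_gt0.
  have [_ [[x _ <-] fx]] := cf _ (nbhsx_ballx f _ e3).
  have {}fx : `|f - T x| < e / 3 by move: fx; rewrite -ball_normE.
  have -> : T (Q f) - f = P (f - T x) - (f - T x).
    by rewrite linearB PT /P /=; rewrite opprB addrA subrK.
  apply: le_trans (ler_normB _ _) _.
  rewrite [leRHS](_ : _ = 2 * (e / 3) + e / 3); last by field.
  apply: lerD; last exact: ltW.
  by apply: le_trans (P_le _) _; rewrite ler_pM2l// ltW.
- exists T; split => //.
    by exists 1 => x; rewrite mul1r c0_embed_norm.
  by exists 1 => x; rewrite mul1r c0_embed_norm.
- exists P; split.
  + by exists 2.
  + by move=> f; rewrite PT.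
  + apply/seteqP; split=> [_ [f _ <-]|_ [x _ <-]]; first by exists (Q f).
    by exists (T x).
Qed.

End complemented_c0.

(** * The cardinality of the measure algebra *)

Section ternary.
Context (R : realType).
Implicit Types (X Y : set nat) (m n : nat).

(** Base 3 with digits 0 and 1 avoids the double expansions of base 2. *)
Definition ternary_sum X n : R := \sum_(k < n) `[< X k >]%:R * 3^-1 ^+ k.

Lemma ternary_sumS X n :
  ternary_sum X n.+1 = ternary_sum X n + `[< X n >]%:R * 3^-1 ^+ n.
Proof. exact: big_ord_recr. Qed.

(** The added term is the full geometric tail, the sum of all [3^-1 ^+ k] with [k >= m]. *)
Lemma ternary_tail X m n :
  ternary_sum X n <= ternary_sum X m + 3 / 2 * 3^-1 ^+ m.
Proof.
have pow_ge0 j : 0 <= 3^-1 ^+ j :> R by rewrite exprn_ge0.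
have [nm|/ltnW mn] := leqP n m.
  apply: (@le_trans _ _ (ternary_sum X m)); last by rewrite lerDl mulr_ge0.
  rewrite -(subnKC nm); elim: (m - n)%N => [|j IH]; first by rewrite addn0.
  by rewrite addnS ternary_sumS (le_trans IH)// lerDl mulr_ge0.
rewrite -(subnKC mn); move: (n - m)%N => j.
suff : ternary_sum X (m + j) <=
    ternary_sum X m + 3 / 2 * 3^-1 ^+ m - 3 / 2 * 3^-1 ^+ (m + j).
  by move=> /le_trans; apply; rewrite gerBl mulr_ge0.
elim: j => [|j IH]; first by rewrite addn0 addrK.
rewrite addnS ternary_sumS exprS.
have b1 : `[< X (m + j)%N >]%:R * 3^-1 ^+ (m + j) <= 3^-1 ^+ (m + j) :> R.
  by rewrite ler_piMl// lern1 leq_b1.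
lra.
Qed.

Definition ternary X : R := sup (range (ternary_sum X)).

Lemma ternary_sum_le X n : ternary_sum X n <= ternary X.
Proof.
apply: ub_le_sup; last by exists n.
by exists (ternary_sum X 0 + 3 / 2 * 3^-1 ^+ 0) => _ [m _ <-]; exact: ternary_tail.
Qed.

Lemma ternary_le X m : ternary X <= ternary_sum X m + 3 / 2 * 3^-1 ^+ m.
Proof.
apply: ge_sup; first by exists (ternary_sum X 0), 0%N.
by move=> _ [n _ <-]; exact: ternary_tail.
Qed.

(** At the first differing index [k] one sum gains [3^-1 ^+ k], while all later digits of the other
    add at most half of that. *)
Lemma ternary_inj : injective ternary.
Proof.
move=> X Y XY; apply: contrapT => nXY.
have ex : exists k, `[< X k >] != `[< Y k >].
  apply: contrapT => h; apply: nXY; apply/funext => k; apply/propext.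
  have /eqP E : `[< X k >] == `[< Y k >] by apply/negPn/negP => ne; apply: h; exists k.
  by split=> /asboolP; [rewrite E | rewrite -E] => /asboolP.
case: (ex_minnP ex) => k neq kmin.
have E : ternary_sum X k = ternary_sum Y k.
  apply: eq_bigr => i _; congr ((nat_of_bool _)%:R * _).
  apply/eqP; apply: contraT => /kmin.
  by rewrite leqNgt ltn_ord.
have pow_gt0 : 0 < 3^-1 ^+ k :> R by rewrite exprn_gt0.
have := ternary_sum_le X k.+1; have := ternary_le X k.+1.
have := ternary_sum_le Y k.+1; have := ternary_le Y k.+1.
rewrite !ternary_sumS E XY exprS.
by case: asboolP neq; case: asboolP => // _ _ _ /= h1 h2 h3 h4; lra.
Qed.

End ternary.

Section measure_algebra_size.
Context (R : realType).
Notation mu := (@lebesgue_measure R).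
Local Open Scope quotient_scope.

Let rat_ray (q : rat) : set R := `]ratr q, +oo[%classic.

(** Every open ray is a countable union of rational ones. A countable generating family is what lets
    a class of Borel sets be coded by a set of integers. *)
Lemma measurable_rat_ray :
  @measurable _ (measurableTypeR R) = <<s range rat_ray >>.
Proof.
apply/seteqP; split; last first.
  apply: smallest_sub; first exact: sigma_algebra_measurable.
  by move=> _ [q _ <-]; exact: measurable_itv.
rewrite [X in X `<=` _]RGenOInfty.measurableE.
apply: smallest_sub; first exact: smallest_sigma_algebra.
move=> _ [x ->].
have -> : `]x, +oo[%classic =
    \bigcup_(q : rat) (if x < ratr q then rat_ray q else set0).
  apply/seteqP; split=> y.
    rewrite /= in_itv andbT => /rat_in_itvoo[q]; rewrite in_itv => /= /andP[xq qy].
    by exists q => //; rewrite xq /rat_ray /= in_itv /= qy.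
  move=> [q _]; case: ifPn => // xq; rewrite /rat_ray /= !in_itv !andbT.
  exact: lt_trans.
apply: (@bigcupT_measurable_rat _ (g_sigma_algebraType (range rat_ray))) => q.
case: ifPn => _; last exact: measurable0.
by apply: sub_sigma_algebra; exists q.
Qed.

Lemma measure_algebra_top_neq_bot : (\top)%O <> (\bot)%O :> measure_algebra R.
Proof.
move=> /pi_null_eq /=; rewrite setY0.
by rewrite lebesgue_measure_itv /= lte_fin ltr01 oppr0 adde0 => /eqP; rewrite eqe oner_eq0.
Qed.

Lemma measure_algebra_inj : exists f : measure_algebra R -> R, injective f.
Proof.
pose val (a : measure_algebra R) : set R := set_val (repr a).
have val_m a : measurable (val a) by exact: borel01_m.
have val_s a : val a `<=` `[0, 1] by exact: borel01_s.
have fin a X : measurable X -> (mu (val a `&` X) < +oo)%E.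
  move=> mX; have mI : measurable (val a `&` X) by exact: measurableI.
  apply: (@le_lt_trans _ _ (mu (`[0, 1] : set R))).
    by apply: le_measure; rewrite ?inE// => x [/val_s].
  by rewrite lebesgue_measure_itv /= lte_fin ltr01 oppr0 adde0 ltry.
(* A measure is determined by its values on the rays with rational endpoints. *)
pose code a : set nat := [set n | exists q r : rat,
   n = pickle (q, r) /\ (mu (val a `&` rat_ray q) < (ratr r)%:E)%E].
exists (ternary R \o code) => a b /ternary_inj ab.
(* Codes record the rationals above each measure, so a larger code means smaller measures: a
   rational strictly between would contradict the inclusion. *)
have ray_le c c' q : code c' `<=` code c ->
    (mu (val c `&` rat_ray q) <= mu (val c' `&` rat_ray q))%E.
  move=> c'c; rewrite leNgt; apply/negP => lt.
  have mq : measurable (rat_ray q) by exact: measurable_itv.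
  have fE e : mu (val e `&` rat_ray q) = (fine (mu (val e `&` rat_ray q)))%:E.
    by rewrite fineK// ge0_fin_numE//; exact: fin.
  move: lt; rewrite (fE c) (fE c') lte_fin => /rat_in_itvoo[r].
  rewrite in_itv => /= /andP[c'r rc].
  have /c'c[q' [r' [/(pcan_inj pickleK)[<- <-]]]] : code c' (pickle (q, r)).
    by exists q, r; rewrite fE lte_fin.
  by rewrite fE lte_fin => /(lt_trans rc); rewrite ltxx.
have ray_eq q : mu (val a `&` rat_ray q) = mu (val b `&` rat_ray q).
  by apply/eqP; rewrite eq_le !ray_le// ab.
have all_eq X : measurable X -> mu (X `&` val a) = mu (X `&` val b).
  move=> mX.
  (* Rational rays are closed under intersection and the rays from [- n%:R] exhaust the line, so two
     finite measures agreeing on all of them coincide. *)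
  apply: (@measure_unique _ R (measurableTypeR R) (range rat_ray)
    (fun n => rat_ray (- n%:R)) measurable_rat_ray _ _ _
    (mrestr mu (val_m a)) (mrestr mu (val_m b))) => //.
  - move=> _ _ [q _ <-] [r _ <-]; exists (Num.max q r) => //.
    rewrite /rat_ray; apply/seteqP; split => x; rewrite /= !in_itv /= !andbT.
      rewrite /Num.max; case: ifPn; rewrite -?leNgt => qr.
        by move=> rx; split=> //; apply: lt_trans rx; rewrite ltr_rat.
      by move=> rx; split=> //; apply: le_lt_trans rx; rewrite ler_rat.
    by move=> [qx rx]; rewrite /Num.max; case: ifP.
  - apply/seteqP; split=> // x _; exists (Num.bound `|- x|) => //.
    rewrite /rat_ray /= in_itv /= andbT rmorphN /= ratr_nat ltrNl.
    by rewrite (le_lt_trans (ler_norm _))// archi_boundP.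
  - move=> _ [q _ <-].
    rewrite -[LHS]/(mu (rat_ray q `&` val a)) -[RHS]/(mu (rat_ray q `&` val b)).
    by rewrite ![rat_ray q `&` _]setIC.
  - move=> n; rewrite -[X in (X < _)%E]/(mu (rat_ray (- n%:R) `&` val a)) setIC.
    by apply: fin; exact: measurable_itv.
rewrite -[a]reprK -[b]reprK; apply/pi_null_eq.
have null c c' : (forall X, measurable X -> mu (X `&` val c) = mu (X `&` val c')) ->
    mu (val c `\` val c') = 0%E.
  move=> cc'; have m : measurable (val c `\` val c') by exact: measurableD.
  have := cc' _ m; rewrite setDKI measure0 => <-; congr (mu _).
  by apply/seteqP; split=> x; rewrite /=; tauto.
rewrite -[X in mu X]/((val a `\` val b) `|` (val b `\` val a)).
have <- : (mu (val a `\` val b) + mu (val b `\` val a) = 0)%E.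
  by rewrite !null ?adde0// => X /all_eq.
apply: measureU.
- by apply: measurableD; exact: val_m.
- by apply: measurableD; exact: val_m.
- by apply/seteqP; split=> x //=; tauto.
Qed.

End measure_algebra_size.

Theorem theorem5p6 (R : realType) (CH : continuum_hypothesis R) :
  exists (K : compactHausdorffType) (i : nat -> K),
    [/\ is_compactification i,
        homeomorphic (~` range i) (stone (measure_algebra R)) &
        contains_complemented_copy (c0 R) (Cfun R K)].
Proof.
have [f f_inj] := measure_algebra_inj R.
have [phi phiF] := faithful_map CH f_inj (@measure_algebra_top_neq_bot R).
have [u] := stone_inhabited (almost_of_faithful phiF).
pose psi := interleave (almost_of_faithful phiF) u.
exists (gamma psi), (@gamma_inl _ _ psi); split.
- exact: gamma_compactification.
- exact: gamma_remainder.
- apply: (@complemented_c0_cvg R (gamma psi) (fun n => inl n.*2.+1) (inr u)).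
  + by move=> m n [/double_inj].
  + move=> n; rewrite (_ : [set _] = [set inl m | m in [set n.*2.+1]]).
      exact: open_gamma_inl.
    by apply/seteqP; split=> [_ ->|_ [_ -> <-]]; [exists n.*2.+1|].
  + exact: interleave_cvg.
Qed.
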